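(* Let $Q$ be a Hausdorff, connected, locally path-connected space and let $G$ be a $Q$-group. The category of discrete $G$-modules is equivalent to the category of discrete $\hat{\pi}_0(G)$-modules.
   Context: A $Q$-space is a Hausdorff, locally path-connected space $X$ with a continuous map $X\to Q$, written $x\mapsto\|x\|$; morphisms are continuous maps over $Q$. A $Q$-group is a group object in $Q$-spaces (continuous multiplication $m:G\times_QG\to G$, unit $Q\to G$ and inverse $G\to G$ over $Q$, making every fibre a group). For a discrete group $D$, $D_Q$ denotes the $Q$-group $D\times Q\to Q$ with fibrewise law. A $G$-module is an abelian $Q$-group $N\to Q$ with a continuous action $G\times_QN\to N$ over $Q$ which is fibrewise an action by group automorphisms. A $G$-module is discrete if its underlying $Q$-group is of the form $M_Q$ for some discrete abelian group $M$. Morphisms are $G$-equivariant morphisms of $Q$-groups. A discrete $\hat\pi_0(G)$-module is a discrete abelian group with a linear action of the discrete group $\hat\pi_0(G)$. The group $\hat\pi_0(G)$: for $c_1,c_2\in\pi_0(G)$ let $c_1\cdot c_2$ be the set of connected components of $G$ meeting $m(c_1\times_Qc_2)$; $\hat\pi_0(G)=\langle\pi_0(G)\mid c_1c_2c_3^{-1},\ c_3\in c_1\cdot c_2\rangle$. *)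

(* Defs.v *)
From HB Require Import structures.
From mathcomp Require Import generic_quotient.
From mathcomp Require Import all_boot all_order all_algebra.
From mathcomp Require Import all_classical all_reals topology normedtype.

Set Implicit Arguments.
Unset Strict Implicit.
Unset Printing Implicit Defensive.

Import Order.TTheory GRing.Theory Num.Theory.
Import numFieldNormedType.Exports.

Local Open Scope classical_set_scope.

Record category := Category {
  obj :> Type;
  hom : obj -> obj -> Type;
  idm : forall x, hom x x;
  ccomp : forall x y z, hom y z -> hom x y -> hom x z;
  ccomp_idl : forall x y (f : hom x y), ccomp (idm y) f = f;
  ccomp_idr : forall x y (f : hom x y), ccomp f (idm x) = f;
  ccompA : forall w x y z (f : hom y z) (g : hom x y) (h : hom w x),
    ccomp f (ccomp g h) = ccomp (ccomp f g) h }.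
Arguments hom {c} _ _.
Arguments idm {c} _.
Arguments ccomp {c x y z} _ _.

Definition is_iso (C : category) (x y : C) (f : hom x y) : Prop :=
  exists g : hom y x, ccomp g f = idm x /\ ccomp f g = idm y.

Record functor (C D : category) := Functor {
  fobj :> C -> D;
  fmap : forall x y, hom x y -> hom (fobj x) (fobj y);
  fmap_id : forall x, fmap (idm x) = idm (fobj x);
  fmap_comp : forall x y z (f : hom y z) (g : hom x y),
    fmap (ccomp f g) = ccomp (fmap f) (fmap g) }.
Arguments fmap {C D} _ {x y} _.

Definition id_functor (C : category) : functor C C :=
  @Functor C C id (fun _ _ => id) (fun _ => erefl) (fun _ _ _ _ _ => erefl).

Definition comp_functor (C D E : category)
    (G : functor D E) (F : functor C D) : functor C E :=
  @Functor C E (fun x => G (F x)) (fun x y f => fmap G (fmap F f))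
    (fun x => etrans (congr1 (fmap G) (fmap_id F x)) (fmap_id G (F x)))
    (fun x y z f g => etrans (congr1 (fmap G) (fmap_comp F f g))
                             (fmap_comp G (fmap F f) (fmap F g))).

Definition naturally_isomorphic (C D : category) (F G : functor C D) : Prop :=
  exists eta : forall x, hom (F x) (G x),
    (forall x, is_iso (eta x)) /\
    (forall x y (f : hom x y), ccomp (eta y) (fmap F f) = ccomp (fmap G f) (eta x)).

Definition equivalent_categories (C D : category) : Prop :=
  exists (F : functor C D) (G : functor D C),
    naturally_isomorphic (comp_functor G F) (id_functor C) /\
    naturally_isomorphic (comp_functor F G) (id_functor D).

Definition full_subcategory (C : category) (P : C -> Prop) : category :=
  @Category {x : C | P x} (fun x y => hom (sval x) (sval y))
    (fun x => idm (sval x)) (fun x y z f g => ccomp f g)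
    (fun x y f => ccomp_idl f) (fun x y f => ccomp_idr f)
    (fun w x y z f g h => ccompA f g h).

Section Presentation.
Variables (S : choiceType) (rel : set (seq (S * bool))).

(* A letter [(s, false)] stands for [s], a letter [(s, true)] for [s^-1]. *)
Local Notation word := (seq (S * bool)).

Definition flip (l : S * bool) : S * bool := (l.1, ~~ l.2).

Inductive pres_eq : word -> word -> Prop :=
| pres_refl w : pres_eq w w
| pres_sym v w : pres_eq v w -> pres_eq w v
| pres_trans u v w : pres_eq u v -> pres_eq v w -> pres_eq u w
| pres_cat v v' w w' : pres_eq v v' -> pres_eq w w' ->
    pres_eq (v ++ w) (v' ++ w')
| pres_cancel l : pres_eq [:: l; flip l] [::]
| pres_rel w : rel w -> pres_eq w [::].

Definition pres_eqb (v w : word) : bool := `[< pres_eq v w >].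

Lemma pres_eqb_equiv : equiv_class_of pres_eqb.
Proof.
split=> [w|v w|v u w].
- exact/asboolP/pres_refl.
- by apply/idP/idP => /asboolP/pres_sym/asboolP.
- move=> /asboolP uv /asboolP vw; apply/asboolP; exact: pres_trans uv vw.
Qed.

Canonical pres_equiv := EquivRelPack pres_eqb_equiv.

Definition presented_group := {eq_quot pres_equiv}%qT.
HB.instance Definition _ := Choice.on presented_group.

Definition word_class (w : word) : presented_group := (\pi_presented_group w)%qT.

Definition presented_gen (s : S) : presented_group := word_class [:: (s, false)].

Definition inv_word (w : word) : word := rev (map flip w).

Definition pres_one : presented_group := word_class [::].
Definition pres_mul (x y : presented_group) : presented_group :=
  word_class (repr x ++ repr y)%qT.
Definition pres_inv (x : presented_group) : presented_group :=
  word_class (inv_word (repr x)%qT).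

Lemma word_classP v w : word_class v = word_class w <-> pres_eq v w.
Proof. by split=> [/eqmodP/asboolP|vw]//; apply/eqmodP/asboolP. Qed.

Lemma word_classK x : word_class (repr x)%qT = x.
Proof. exact: reprK. Qed.

Lemma repr_word_class w : pres_eq (repr (word_class w))%qT w.
Proof. by apply/word_classP; rewrite word_classK. Qed.

Lemma flipK : involutive flip.
Proof. by case=> s b; rewrite /flip /= negbK. Qed.

Lemma inv_wordK : involutive inv_word.
Proof. by move=> w; rewrite /inv_word map_rev revK mapK//; exact: flipK. Qed.

Lemma inv_wordV w : pres_eq (w ++ inv_word w) [::].
Proof.
elim: w => [|l w IHw]; first exact: pres_refl.
have -> : (l :: w) ++ inv_word (l :: w) =
    [:: l] ++ ((w ++ inv_word w) ++ [:: flip l]).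
  by rewrite /inv_word /= rev_cons -cats1 catA.
apply: pres_trans (pres_cancel l).
rewrite -[[:: l; flip l]]/([:: l] ++ ([::] ++ [:: flip l])).
apply: pres_cat; first exact: pres_refl.
apply: pres_cat; [exact: IHw | exact: pres_refl].
Qed.

Lemma pres_mulE v w :
  pres_mul (word_class v) (word_class w) = word_class (v ++ w).
Proof. by apply/word_classP; apply: pres_cat; exact: repr_word_class. Qed.

Lemma pres_mulA : associative pres_mul.
Proof.
move=> x y z; rewrite -(word_classK x) -(word_classK y) -(word_classK z).
by rewrite !pres_mulE catA.
Qed.

Lemma pres_mul1 : left_id pres_one pres_mul.
Proof. by move=> x; rewrite -(word_classK x) pres_mulE. Qed.

Lemma pres_mulr1 : right_id pres_one pres_mul.
Proof. by move=> x; rewrite -(word_classK x) pres_mulE cats0. Qed.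

Lemma pres_mulV : right_inverse pres_one pres_inv pres_mul.
Proof.
move=> x; rewrite -{1}(word_classK x) pres_mulE; apply/word_classP.
exact: inv_wordV.
Qed.

Lemma pres_mulVl : left_inverse pres_one pres_inv pres_mul.
Proof.
move=> x; rewrite -{2}(word_classK x) pres_mulE; apply/word_classP.
by rewrite -{2}[repr x]inv_wordK; exact: inv_wordV.
Qed.

HB.instance Definition _ := isGroup.Build presented_group
  pres_mulA pres_mul1 pres_mulr1 pres_mulVl pres_mulV.

End Presentation.

Section ToMultiplicative.
Variable V : zmodType.
HB.instance Definition _ := hasInv.Build (Algebra.to_multiplicative V) (@GRing.opp V).
HB.instance Definition _ :=
  Monoid_isGroup.Build (Algebra.to_multiplicative V) (@addNr V) (@addrN V).
End ToMultiplicative.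

Section LocallyPathConnected.
Variables (R : realType) (X : topologicalType).
Local Open Scope ring_scope.

(* [R] only supplies the unit interval; any two realTypes are isomorphic. *)
Definition path_connected (A : set X) : Prop :=
  forall x y, A x -> A y -> exists p : R -> X,
    [/\ {within `[0, 1], continuous p}, p 0 = x, p 1 = y & p @` `[0, 1] `<=` A].

Definition locally_path_connected : Prop :=
  forall (x : X) (U : set X), nbhs x U ->
    exists V : set X, [/\ open V, V x, V `<=` U & path_connected V].

End LocallyPathConnected.

(* [qnorm] is the structure map [x |-> ||x||] to [Q]. *)
Record qspace (R : realType) (Q : topologicalType) := QSpace {
  qcarrier :> topologicalType;
  qnorm : qcarrier -> Q;
  qnorm_continuous : continuous qnorm;
  qhausdorff : hausdorff_space qcarrier;
  qlocally_path_connected : locally_path_connected R qcarrier }.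
Arguments qnorm {R Q _} _.

Section QSpaceTheory.
Variables (R : realType) (Q : topologicalType).
Local Notation qspace := (qspace R Q).

(* Used as a type, this set carries the subspace topology of [X * Y]. *)
Definition fib_prod (X Y : qspace) : set (X * Y) :=
  [set z | qnorm z.1 = qnorm z.2].
Arguments fib_prod : clear implicits.

Definition fpair (X Y : qspace) (x : X) (y : Y) (h : qnorm x = qnorm y) :
    fib_prod X Y :=
  exist _ (x, y) (mem_set (h : fib_prod X Y (x, y))).

Definition is_qspace_hom (X Y : qspace) (f : X -> Y) : Prop :=
  continuous f /\ forall x, qnorm (f x) = qnorm x.

End QSpaceTheory.
Arguments fib_prod {R Q} X Y.

(* The pairing argument [h] of a fibrewise operation is a proof that two points
   lie over the same point of [Q]; the laws quantify over all such proofs. *)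
Record qgroup (R : realType) (Q : topologicalType) := QGroup {
  qg_space :> qspace R Q;
  qg_mul : fib_prod qg_space qg_space -> qg_space;
  qg_one : Q -> qg_space;
  qg_inv : qg_space -> qg_space;
  qg_mul_continuous : continuous qg_mul;
  qg_one_continuous : continuous qg_one;
  qg_inv_continuous : continuous qg_inv;
  qg_mul_norm : forall z, qnorm (qg_mul z) = qnorm (val z).1;
  qg_one_norm : forall q, qnorm (qg_one q) = q;
  qg_inv_norm : forall x, qnorm (qg_inv x) = qnorm x;
  qg_mulA : forall (x y z : qg_space) (hxy : qnorm x = qnorm y)
      (hyz : qnorm y = qnorm z)
      (hl : qnorm (qg_mul (fpair hxy)) = qnorm z)
      (hr : qnorm x = qnorm (qg_mul (fpair hyz))),
    qg_mul (fpair hl) = qg_mul (fpair hr);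
  qg_mul1x : forall (x : qg_space) (h : qnorm (qg_one (qnorm x)) = qnorm x),
    qg_mul (fpair h) = x;
  qg_mulx1 : forall (x : qg_space) (h : qnorm x = qnorm (qg_one (qnorm x))),
    qg_mul (fpair h) = x;
  qg_mulVx : forall (x : qg_space) (h : qnorm (qg_inv x) = qnorm x),
    qg_mul (fpair h) = qg_one (qnorm x);
  qg_mulxV : forall (x : qg_space) (h : qnorm x = qnorm (qg_inv x)),
    qg_mul (fpair h) = qg_one (qnorm x) }.
Arguments qg_mul {R Q _} _.
Arguments qg_one {R Q} _ _.
Arguments qg_inv {R Q _} _.

Section QGroupTheory.
Variables (R : realType) (Q : topologicalType).
Local Notation qgroup := (qgroup R Q).

Definition qg_abelian (N : qgroup) : Prop :=
  forall (x y : N) (h : qnorm x = qnorm y) (h' : qnorm y = qnorm x),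
    qg_mul (fpair h) = qg_mul (fpair h').

Definition is_qgroup_hom (N N' : qgroup) (f : N -> N') : Prop :=
  is_qspace_hom f /\
  forall (x y : N) (h : qnorm x = qnorm y) (h' : qnorm (f x) = qnorm (f y)),
    f (qg_mul (fpair h)) = qg_mul (fpair h').

Definition qgroup_isomorphic (N N' : qgroup) : Prop :=
  exists (f : N -> N') (g : N' -> N),
    [/\ is_qgroup_hom f, is_qgroup_hom g, cancel f g & cancel g f].

End QGroupTheory.

Section ConstantQGroup.
Variables (R : realType) (Q : topologicalType).
Hypotheses (hQ : hausdorff_space Q) (lQ : locally_path_connected R Q).

Section Space.
Variable T : choiceType.
Local Notation TQ := (discrete_topology T * Q)%type.

Lemma const_snd_continuous : continuous (snd : TQ -> Q).
Proof. by move=> x; exact: cvg_snd. Qed.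

Lemma const_hausdorff : hausdorff_space TQ.
Proof.
move=> [a p] [b q] cl.
have ab : a = b.
  have [||[c r] [[/= ca _] [/= cb _]]] := cl ([set a] `*` setT) ([set b] `*` setT).
  - exists ([set a], setT) => //; split=> /=; last exact: filterT.
    exact: (@discrete_set1 (discrete_topology T)).
  - exists ([set b], setT) => //; split=> /=; last exact: filterT.
    exact: (@discrete_set1 (discrete_topology T)).
  - by rewrite -ca -cb.
rewrite -ab; congr (_, _); apply: hQ => A B Ap Bq.
have [||[c r] [[_ /= Ar] [_ /= Br]]] := cl (setT `*` A) (setT `*` B).
- by exists (setT, A) => //; split=> //=; exact: filterT.
- by exists (setT, B) => //; split=> //=; exact: filterT.
- by exists r.
Qed.

Lemma const_locally_path_connected : locally_path_connected R TQ.
Proof.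
move=> [a q] U [[A B] /= [Aa Bq] ABU].
have [V [oV Vq VB pV]] := lQ Bq.
exists ([set a] `*` V); split.
- rewrite openE => -[_ r] [/= -> Vr]; exists ([set a], V) => //; split=> /=.
    exact: (@discrete_set1 (discrete_topology T)).
  exact: open_nbhs_nbhs.
- by [].
- move=> [_ r] [/= -> Vr]; apply: ABU; split=> /=; last exact: VB.
  exact: nbhs_singleton Aa.
- move=> [_ x] [_ y] [/= -> Vx] [/= -> Vy].
  have [p [cp p0 p1 pIV]] := pV x y Vx Vy.
  exists (fun t => (a : discrete_topology T, p t)); split => /=.
  + move=> t; apply: (@cvg_pair _ _ _ _ (nbhs (a : discrete_topology T))).
      exact: cvg_cst.
    exact: cp.
  + by rewrite p0.
  + by rewrite p1.
  + by move=> _ [t tI <-]; split=> //=; apply: pIV; exists t.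
Qed.

Definition const_qspace : qspace R Q :=
  @QSpace R Q TQ snd const_snd_continuous const_hausdorff
    const_locally_path_connected.

End Space.

Section Group.
Variable D : groupType.
Local Notation DQ := (const_qspace D).
Local Open Scope group_scope.

Definition const_mul (z : fib_prod DQ DQ) : DQ :=
  (((val z).1.1 : D) * ((val z).2.1 : D), (val z).1.2).
Definition const_one (q : Q) : DQ := ((1 : D), q).
Definition const_inv (x : DQ) : DQ := ((x.1 : D)^-1, x.2).

Lemma pair_continuous (X Y Z : topologicalType) (f : X -> Y) (g : X -> Z) :
  continuous f -> continuous g -> continuous (fun x => (f x, g x)).
Proof. by move=> cf cg x; apply: (cvg_pair (cf x) (cg x)). Qed.

Lemma val_continuous (X Y : qspace R Q) :
  continuous (fun z : fib_prod X Y => val z).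
Proof. exact: (@initial_continuous (fib_prod X Y) _ set_val). Qed.

Lemma val_fst_continuous (X Y : qspace R Q) :
  continuous (fun z : fib_prod X Y => (val z).1).
Proof. by move=> z; apply: cvg_comp (@val_continuous X Y z) _; exact: cvg_fst. Qed.

Lemma val_snd_continuous (X Y : qspace R Q) :
  continuous (fun z : fib_prod X Y => (val z).2).
Proof. by move=> z; apply: cvg_comp (@val_continuous X Y z) _; exact: cvg_snd. Qed.

Lemma const_fst_continuous : continuous (fst : DQ -> discrete_topology D).
Proof. by move=> x; exact: cvg_fst. Qed.

Lemma discrete_op_continuous (X : topologicalType)
    (op : D -> D -> D) (f g : X -> discrete_topology D) :
  continuous f -> continuous g ->
  continuous (fun x => op (f x) (g x) : discrete_topology D).
Proof.
move=> cf cg x U /nbhs_singleton /= Ux.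
have fx : nbhs x (f @^-1` [set f x]) :=
  cf x _ (@discrete_set1 (discrete_topology D) (f x)).
have gx : nbhs x (g @^-1` [set g x]) :=
  cg x _ (@discrete_set1 (discrete_topology D) (g x)).
by apply: filterS (filterI fx gx) => y [/= fy gy]; rewrite /= fy gy.
Qed.

Lemma const_mul_continuous : continuous const_mul.
Proof.
apply: (@pair_continuous _ (discrete_topology D) Q); last first.
  move=> z; apply: cvg_comp (@val_fst_continuous DQ DQ z) _; exact: cvg_snd.
apply: discrete_op_continuous => z.
  by apply: cvg_comp (@val_fst_continuous DQ DQ z) _; exact: cvg_fst.
by apply: cvg_comp (@val_snd_continuous DQ DQ z) _; exact: cvg_fst.
Qed.

Lemma const_one_continuous : continuous const_one.
Proof.
apply: (@pair_continuous _ (discrete_topology D) Q) => q; first exact: cvg_cst.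
exact: cvg_id.
Qed.

Lemma const_inv_continuous : continuous const_inv.
Proof.
apply: (@pair_continuous _ (discrete_topology D) Q); last first.
  by move=> x; exact: cvg_snd.
apply: (@discrete_op_continuous _ (fun a _ => a^-1) fst fst);
  exact: const_fst_continuous.
Qed.

Definition const_qgroup : qgroup R Q.
Proof.
refine (@QGroup R Q DQ const_mul const_one const_inv const_mul_continuous
  const_one_continuous const_inv_continuous _ _ _ _ _ _ _ _) => //=.
- by move=> x y z hxy hyz hl hr; rewrite /const_mul /= mulgA.
- by move=> [a q] h; rewrite /const_mul /= mul1g.
- by move=> [a q] h; rewrite /const_mul /= mulg1.
- by move=> [a q] h; rewrite /const_mul /const_one /= mulVg.
- by move=> [a q] h; rewrite /const_mul /const_one /= mulgV.
Defined.

End Group.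
End ConstantQGroup.

Record gmodule (R : realType) (Q : topologicalType) (G : qgroup R Q) := GModule {
  gm_qgroup :> qgroup R Q;
  gm_abelian : qg_abelian gm_qgroup;
  gm_act : fib_prod G gm_qgroup -> gm_qgroup;
  gm_act_continuous : continuous gm_act;
  gm_act_norm : forall z, qnorm (gm_act z) = qnorm (val z).2;
  gm_act1 : forall (n : gm_qgroup) (h : qnorm (qg_one G (qnorm n)) = qnorm n),
    gm_act (fpair h) = n;
  gm_actM : forall (a b : G) (n : gm_qgroup)
      (hab : qnorm a = qnorm b) (hbn : qnorm b = qnorm n)
      (hl : qnorm (qg_mul (fpair hab)) = qnorm n)
      (hr : qnorm a = qnorm (gm_act (fpair hbn))),
    gm_act (fpair hl) = gm_act (fpair hr);
  gm_actD : forall (a : G) (n n' : gm_qgroup)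
      (hnn' : qnorm n = qnorm n')
      (han : qnorm a = qnorm n) (han' : qnorm a = qnorm n')
      (hl : qnorm a = qnorm (qg_mul (fpair hnn')))
      (hr : qnorm (gm_act (fpair han)) = qnorm (gm_act (fpair han'))),
    gm_act (fpair hl) = qg_mul (fpair hr) }.
Arguments gm_act {R Q G _} _.

Section GModuleCategory.
Variables (R : realType) (Q : topologicalType) (G : qgroup R Q).

Definition is_gmodule_hom (N N' : gmodule G) (f : N -> N') : Prop :=
  is_qgroup_hom f /\
  forall (a : G) (n : N) (h : qnorm a = qnorm n) (h' : qnorm a = qnorm (f n)),
    f (gm_act (fpair h)) = gm_act (fpair h').

Lemma is_gmodule_hom_id (N : gmodule G) : is_gmodule_hom (id : N -> N).
Proof.
split; last by move=> a n h h'; rewrite (Prop_irrelevance h h').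
split; last by move=> x y h h'; rewrite (Prop_irrelevance h h').
by split=> // x; exact: cvg_id.
Qed.

Lemma is_gmodule_hom_comp (N1 N2 N3 : gmodule G) (f : N2 -> N3) (g : N1 -> N2) :
  is_gmodule_hom f -> is_gmodule_hom g -> is_gmodule_hom (f \o g).
Proof.
move=> [[[cf nf] mf] af] [[[cg ng] mg] ag]; split; last first.
  move=> a n h h' /=; have hg : qnorm a = qnorm (g n) by rewrite ng.
  by rewrite (ag a n h hg); exact: af.
split; last first.
  move=> x y h h' /=; have hg : qnorm (g x) = qnorm (g y) by rewrite !ng.
  by rewrite (mg x y h hg); exact: mf.
split=> [x|x /=]; last by rewrite nf ng.
by apply: cvg_comp (cg x) _; exact: cf.
Qed.

Definition gmodule_hom (N N' : gmodule G) := {f : N -> N' | is_gmodule_hom f}.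

Definition gmodule_category : category.
Proof.
refine (@Category (gmodule G) gmodule_hom
  (fun N => exist _ _ (is_gmodule_hom_id N))
  (fun N1 N2 N3 f g => exist _ _ (is_gmodule_hom_comp (svalP f) (svalP g)))
  _ _ _).
- by move=> N N' [f hf]; exact: eq_exist.
- by move=> N N' [f hf]; exact: eq_exist.
- by move=> N1 N2 N3 N4 [f hf] [g hg] [k hk]; exact: eq_exist.
Defined.

Hypotheses (hQ : hausdorff_space Q) (lQ : locally_path_connected R Q).

(* "Of the form [M_Q]" is read up to isomorphism of [Q]-groups. *)
Definition is_discrete_gmodule (N : gmodule G) : Prop :=
  exists M : zmodType,
    qgroup_isomorphic N (const_qgroup hQ lQ (Algebra.to_multiplicative M)).

Definition discrete_gmodule_category : category :=
  @full_subcategory gmodule_category is_discrete_gmodule.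

End GModuleCategory.
Arguments discrete_gmodule_category {R Q} G hQ lQ.

Definition pi0 (X : topologicalType) : set (set X) :=
  range (connected_component [set: X]).
Arguments pi0 : clear implicits.

Section Pi0Hat.
Variables (R : realType) (Q : topologicalType) (G : qgroup R Q).

Definition comp_mul (c1 c2 : pi0 G) : set (pi0 G) :=
  [set c3 | qg_mul @` [set z : fib_prod G G |
                        val c1 (val z).1 /\ val c2 (val z).2]
            `&` val c3 !=set0].

Definition pi0hat_relators : set (seq (pi0 G * bool)) :=
  [set w | exists c1 c2 c3 : pi0 G, comp_mul c1 c2 c3 /\
     w = [:: (c1, false); (c2, false); (c3, true)]].

Definition pi0hat : groupType := presented_group pi0hat_relators.

End Pi0Hat.

(* A discrete abelian group is just an abelian group, and any map out of it is
   continuous, so no topology appears. *)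
Record group_module (P : groupType) := GroupModule {
  grm_zmod :> zmodType;
  grm_act : P -> grm_zmod -> grm_zmod;
  grm_act1 : forall m, grm_act 1%g m = m;
  grm_actM : forall a b m, grm_act (a * b)%g m = grm_act a (grm_act b m);
  grm_actD : forall a, {morph grm_act a : m n / (m + n)%R} }.
Arguments grm_act {P _} _ _.

Section GroupModuleCategory.
Variable P : groupType.

Definition is_group_module_hom (M N : group_module P) (f : M -> N) : Prop :=
  {morph f : m n / (m + n)%R} /\
  forall a m, f (grm_act a m) = grm_act a (f m).

Lemma is_group_module_hom_id (M : group_module P) :
  is_group_module_hom (id : M -> M).
Proof. by []. Qed.

Lemma is_group_module_hom_comp (M1 M2 M3 : group_module P)
    (f : M2 -> M3) (g : M1 -> M2) :
  is_group_module_hom f -> is_group_module_hom g -> is_group_module_hom (f \o g).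
Proof.
move=> [fD fa] [gD ga]; split=> [m n|a m] /=; first by rewrite gD fD.
by rewrite ga fa.
Qed.

Definition group_module_hom (M N : group_module P) :=
  {f : M -> N | is_group_module_hom f}.

Definition group_module_category : category.
Proof.
refine (@Category (group_module P) group_module_hom
  (fun M => exist _ _ (is_group_module_hom_id M))
  (fun M1 M2 M3 f g =>
     exist _ _ (is_group_module_hom_comp (svalP f) (svalP g)))
  _ _ _).
- by move=> M N [f hf]; exact: eq_exist.
- by move=> M N [f hf]; exact: eq_exist.
- by move=> M1 M2 M3 M4 [f hf] [g hg] [k hk]; exact: eq_exist.
Defined.

End GroupModuleCategory.

(* Main.v *)
From Pilot Require Import Defs.
From mathcomp Require Import generic_quotient.
From mathcomp Require Import all_boot all_order all_algebra.
From mathcomp Require Import all_classical all_reals topology normedtype.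

(** Everything rests on one remark: a continuous map into a discrete space is
    constant on connected sets ([locally_constant_on_connected]).

    From a module [M] over the group pi0hat(G) one builds the constant module
    [M x Q] on which [a] in [G] acts through the class of its connected
    component ([const_gmodule]).  Components of a locally path-connected space
    are open, so this action is continuous, and the defining relations of
    pi0hat(G) make it multiplicative ([pi0hat_classM]).  The functor
    so obtained ([const_functor]) is an equivalence because it is fully
    faithful and essentially surjective ([equivalence_of_fully_faithful]).

    It is full ([const_map_full]): for a morphism [g] from [M x Q] to [N x Q]
    and a fixed [m], the first coordinate of [g (m, q)] depends continuously
    on [q], hence not at all, since [Q] is connected.  So [g] is of the form
    [f x id], and [f] commutes with the generators of pi0hat(G), because every
    component of [G] has a point; therefore it commutes with the whole group.
    It is faithful because [Q] has a point.

    It is essentially surjective: let [N] be isomorphic to [M x Q] as a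
    [Q]-group.  Transporting the action of [G] gives, for each [a] over [q],
    an automorphism of the fibre [M x {q}], that is, of [M]
    ([fibre_act]).  For a fixed [m] the result depends continuously on
    [a], hence only on the component of [a].  A component thus acts on [M], the
    relators act trivially, and the action extends to pi0hat(G)
    ([component_module]).  The given isomorphism of [Q]-groups is then
    equivariant ([trivialization_equivariant]). *)

Set Implicit Arguments.
Unset Strict Implicit.
Unset Printing Implicit Defensive.

Import GRing.Theory Num.Theory Order.TTheory.
Import numFieldNormedType.Exports.
(* So that [hom] denotes the morphisms of a category, not the linear maps. *)
Import Pilot.Defs.

Local Open Scope classical_set_scope.

(** * Fully faithful and essentially surjective functors *)

Section FullyFaithful.
Variables (C D : category) (H : functor D C).
Hypothesis H_full : forall (x y : D) (h : hom (H x) (H y)), exists f, fmap H f = h.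
Hypothesis H_faithful : forall (x y : D) (f g : hom x y), fmap H f = fmap H g -> f = g.
Hypothesis H_surj : forall c : C, exists (d : D) (i : hom (H d) c), is_iso i.

Lemma fully_faithful_reflects_iso (x y : D) (f : hom x y) :
  is_iso (fmap H f) -> is_iso f.
Proof.
move=> [h [hf fh]]; have [g Hg] := H_full h; exists g.
by split; apply: H_faithful; rewrite fmap_comp fmap_id Hg.
Qed.

(** Choosing [F0 c] and an isomorphism [eps c] from [H (F0 c)] to [c] for every
    object [c], the quasi-inverse sends [f] to the unique preimage under [H] of
    its conjugate by [eps]; uniqueness gives functoriality. *)
Lemma equivalence_of_fully_faithful : equivalent_categories C D.
Proof.
have inv_ex (c : C) : exists d : D, exists i : hom (H d) c, exists j : hom c (H d),
    ccomp j i = idm (H d) /\ ccomp i j = idm c.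
  by have [d [i [j ij]]] := H_surj c; exists d, i, j.
pose F0 c : D := sval (cid (inv_ex c)).
pose eps_ex c := svalP (cid (inv_ex c)).
pose eps c : hom (H (F0 c)) c := sval (cid (eps_ex c)).
pose eta_ex c := svalP (cid (eps_ex c)).
pose eta c : hom c (H (F0 c)) := sval (cid (eta_ex c)).
have etaK c : ccomp (eta c) (eps c) = idm (H (F0 c)).
  exact: (svalP (cid (eta_ex c))).1.
have epsK c : ccomp (eps c) (eta c) = idm c.
  exact: (svalP (cid (eta_ex c))).2.
pose lift (x y : D) (h : hom (H x) (H y)) : hom x y := sval (cid (H_full h)).
have liftE (x y : D) (h : hom (H x) (H y)) : fmap H (lift x y h) = h.
  exact: svalP (cid (H_full h)).
pose F1 (c c' : C) (f : hom c c') : hom (F0 c) (F0 c') :=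
  lift _ _ (ccomp (eta c') (ccomp f (eps c))).
have F1E (c c' : C) (f : hom c c') :
  fmap H (F1 c c' f) = ccomp (eta c') (ccomp f (eps c)) by exact: liftE.
have F1_id c : F1 c c (idm c) = idm (F0 c).
  by apply: H_faithful; rewrite F1E fmap_id ccomp_idl etaK.
have F1_comp (x y z : C) (f : hom y z) (g : hom x y) :
    F1 x z (ccomp f g) = ccomp (F1 y z f) (F1 x y g).
  apply: H_faithful; rewrite fmap_comp !F1E -!ccompA.
  by rewrite (ccompA (eps y)) epsK ccomp_idl.
pose F := @Functor C D F0 F1 F1_id F1_comp.
exists F, H; split.
- exists eps; split=> [c|x y f].
    by exists (eta c); split; [exact: etaK | exact: epsK].
  by rewrite /= F1E ccompA epsK ccomp_idl.
- pose theta (d : D) : hom (F0 (H d)) d := lift _ _ (eps (H d)).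
  exists theta; split=> [d|x y f].
    apply: fully_faithful_reflects_iso; rewrite liftE.
    by exists (eta (H d)); split; [exact: etaK | exact: epsK].
  apply: H_faithful; rewrite !fmap_comp !liftE /=.
  by rewrite ccompA epsK ccomp_idl.
Qed.

End FullyFaithful.

(** * Connected components and maps to discrete spaces *)

(** The fibre of [f] through [x] is open and closed, since so is every subset
    of a discrete space. *)
Lemma locally_constant_on_connected (X : topologicalType) (T : choiceType)
    (f : X -> discrete_topology T) (A : set X) (x y : X) :
  continuous f -> connected A -> A x -> A y -> f x = f y.
Proof.
move=> cf cA Ax Ay.
have /seteqP [_ /(_ y Ay) [_ /= <- //]] : A `&` (f @^-1` [set f x]) = A.
have /continuousP fo := cf.
apply: cA; first by exists x.
- by exists (f @^-1` [set f x]) => //; apply: fo; exact: discrete_open.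
- exists (f @^-1` [set f x]) => //.
  by apply: preimage_closed => [z _|]; [exact: cf | exact: discrete_closed].
Qed.

Definition component_of (X : topologicalType) (x : X) : pi0 X :=
  exist _ (connected_component setT x)
    (mem_set (imageT (connected_component [set: X]) x)).

(** Components are open: all points of a path-connected neighbourhood of [x] are
    joined to [x] by paths. *)
Lemma component_of_near (R : realType) (X : topologicalType) (x : X) :
  locally_path_connected R X ->
  \forall y \near x, component_of y = component_of x.
Proof.
move=> lX; have [V [oV Vx _ pV]] := lX x setT filterT.
apply: filterS (open_nbhs_nbhs (conj oV Vx)) => y Vy.
apply/val_inj => /=; apply/esym/same_connected_component.
have [p [cp p0 p1 _]] := pV x y Vx Vy.
apply: (@connected_component_max _ setT (p @` `[0%R, 1%R])) => //.
- by exists 0%R => //=; rewrite in_itv /= lexx ler01.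
- by apply: connected_continuous_connected => //; exact: segment_connected.
- by exists 1%R => //=; rewrite in_itv /= lexx ler01.
Qed.

Lemma discrete_map_same_component (X : topologicalType) (T : choiceType)
    (f : X -> discrete_topology T) (x y : X) :
  continuous f -> component_of x = component_of y -> f x = f y.
Proof.
move=> cf /(congr1 val) /= xy.
apply: (@locally_constant_on_connected _ _ _ (connected_component setT x)) => //.
- exact: component_connected.
- exact: connected_component_refl.
- by rewrite xy; exact: connected_component_refl.
Qed.

Lemma pi0P (X : topologicalType) (c : pi0 X) : exists x, component_of x = c.
Proof. by case: c => c hc; have [x _ xc] := set_mem hc; exists x; exact: val_inj. Qed.

Lemma comp_continuous (X Y Z : topologicalType) (f : X -> Y) (g : Y -> Z) :
  continuous f -> continuous g -> continuous (fun x => g (f x)).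
Proof. by move=> cf cg x; exact: continuous_comp (cf x) (cg (f x)). Qed.

Lemma discrete_op2_continuous (X : topologicalType) (A B C : choiceType)
    (op : A -> B -> C) (f : X -> discrete_topology A) (g : X -> discrete_topology B) :
  continuous f -> continuous g ->
  continuous (fun x => op (f x) (g x) : discrete_topology C).
Proof.
move=> cf cg x U /nbhs_singleton /= Ux.
have fx : nbhs x (f @^-1` [set f x]) :=
  cf x _ (@discrete_set1 (discrete_topology A) (f x)).
have gx : nbhs x (g @^-1` [set g x]) :=
  cg x _ (@discrete_set1 (discrete_topology B) (g x)).
by apply: filterS (filterI fx gx) => y [/= fy gy]; rewrite /= fy gy.
Qed.

Lemma fpair_eq (R : realType) (Q : topologicalType) (X Y : qspace R Q)
    (x x' : X) (y y' : Y) (h : qnorm x = qnorm y) (h' : qnorm x' = qnorm y') :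
  x = x' -> y = y' -> fpair h = fpair h'.
Proof. by move=> xx' yy'; apply/val_inj; rewrite /= xx' yy'. Qed.

(** * Groups given by generators and relations *)

Section PresentedGroup.
Variables (S : choiceType) (rel : set (seq (S * bool))).
Local Notation P := (presented_group rel).
Local Notation gen := (presented_gen rel).
Local Open Scope group_scope.

Lemma word_class_cat v w :
  word_class rel (v ++ w) = word_class rel v * word_class rel w :> P.
Proof. by rewrite -pres_mulE. Qed.

Lemma word_class_inv_gen s : word_class rel [:: (s, true)] = (gen s)^-1 :> P.
Proof.
apply: (mulgI (gen s)); rewrite mulgV -word_class_cat.
exact/word_classP/pres_cancel.
Qed.

Lemma presented_group_ind (A : P -> Prop) :
  A 1 -> (forall s x, A x -> A (gen s * x)) ->
  (forall s x, A x -> A ((gen s)^-1 * x)) -> forall x, A x.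
Proof.
move=> A1 Ag AV x; rewrite -(word_classK x); elim: (repr x) => [//|[s b] w IHw].
rewrite -cat1s word_class_cat; case: b; last exact: Ag.
by rewrite word_class_inv_gen; exact: AV.
Qed.

Variables (T : Type) (rho rhoV : S -> T -> T).

(** The letter [s] acts by [rho s] and the letter [s^-1] by [rhoV s]; the first
    letter of a word acts last. *)
Definition word_act (w : seq (S * bool)) (t : T) : T :=
  foldr (fun l => if l.2 then rhoV l.1 else rho l.1) t w.

Hypotheses (rhoK : forall s, cancel (rho s) (rhoV s))
  (rhoVK : forall s, cancel (rhoV s) (rho s))
  (rho_rel : forall w, rel w -> forall t, word_act w t = t).

Lemma word_act_cat v w t : word_act (v ++ w) t = word_act v (word_act w t).
Proof. exact: foldr_cat. Qed.

(** This yields the universal property of the presentation, for actions: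
    mutually inverse maps attached to the generators define an action of the
    group, [pres_act], as soon as the relators act trivially. *)
Lemma pres_eq_word_act v w : pres_eq rel v w -> word_act v =1 word_act w.
Proof.
elim=> {v w} // [v w _ IH|u v w _ IHuv _ IHvw|v v' w w' _ IHv _ IHw|[s []]] t.
- by rewrite IH.
- by rewrite IHuv.
- by rewrite !word_act_cat IHw IHv.
- exact: rhoK.
- exact: rhoVK.
Qed.

Definition pres_act (x : P) : T -> T := word_act (repr x)%qT.

Lemma pres_act_class w : pres_act (word_class rel w) =1 word_act w.
Proof. exact/pres_eq_word_act/repr_word_class. Qed.

Lemma pres_act1 t : pres_act 1 t = t.
Proof. exact: (pres_act_class [::]). Qed.

Lemma pres_actM x y t : pres_act (x * y) t = pres_act x (pres_act y t).
Proof. by rewrite [x * y]/(pres_mul x y) /pres_mul pres_act_class word_act_cat. Qed.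

Lemma pres_act_gen s : pres_act (gen s) =1 rho s.
Proof. exact: pres_act_class. Qed.

End PresentedGroup.

Lemma group_moduleK (A : groupType) (M : group_module A) (a : A) :
  cancel (@grm_act _ M a) (grm_act a^-1%g).
Proof. by move=> m; rewrite -grm_actM mulVg grm_act1. Qed.

Lemma group_moduleVK (A : groupType) (M : group_module A) (a : A) :
  cancel (@grm_act _ M a^-1%g) (grm_act a).
Proof. by move=> m; rewrite -grm_actM mulgV grm_act1. Qed.

(** A map that commutes with the action of a generator also commutes with the
    action of its inverse, since generators act bijectively. *)
Lemma equivariant_on_generators (S : choiceType) (rel : set (seq (S * bool)))
    (M N : group_module (presented_group rel)) (f : M -> N) :
  (forall s m, f (grm_act (presented_gen rel s) m) =
               grm_act (presented_gen rel s) (f m)) ->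
  forall a m, f (grm_act a m) = grm_act a (f m).
Proof.
move=> fg; elim/presented_group_ind => [m|s x IHx m|s x IHx m].
- by rewrite !grm_act1.
- by rewrite !grm_actM fg IHx.
- rewrite !grm_actM -IHx; apply: (can_inj (group_moduleK (presented_gen rel s))).
  by rewrite -fg !group_moduleVK.
Qed.

(** * The class of a point of G in pi0hat(G) *)

Section ComponentClass.
Variables (R : realType) (Q : topologicalType) (G : qgroup R Q).
Local Open Scope group_scope.

Definition pi0hat_class (a : G) : pi0hat G :=
  presented_gen (pi0hat_relators (G := G)) (component_of a).

Lemma pi0hat_class_continuous :
  continuous (pi0hat_class : G -> discrete_topology (pi0hat G)).
Proof.
move=> a U /nbhs_singleton /= Ua.
have near_a : nbhs a [set b | component_of b = component_of a].
  exact: component_of_near (@qlocally_path_connected _ _ G).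
by apply: filterS near_a => b /= ba; rewrite /pi0hat_class ba.
Qed.

Lemma comp_mul_component_of (a b : G) (h : qnorm a = qnorm b) :
  comp_mul (component_of a) (component_of b) (component_of (qg_mul (fpair h))).
Proof.
exists (qg_mul (fpair h)); split; last exact: connected_component_refl.
by exists (fpair h) => //; split; exact: connected_component_refl.
Qed.

Lemma pi0hat_classM (a b : G) (h : qnorm a = qnorm b) :
  pi0hat_class (qg_mul (fpair h)) = pi0hat_class a * pi0hat_class b.
Proof.
apply/esym/divg1_eq; rewrite -word_class_inv_gen.
rewrite -(word_class_cat _ [:: (_, false)]) -word_class_cat.
apply/word_classP/pres_rel.
by exists (component_of a), (component_of b), (component_of (qg_mul (fpair h)));
  split=> //; exact: comp_mul_component_of.
Qed.

(** The unit at [q] is idempotent, so its class is too. *)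
Lemma pi0hat_class1 q : pi0hat_class (qg_one G q) = 1.
Proof.
have h : qnorm (qg_one G (qnorm (qg_one G q))) = qnorm (qg_one G q).
  by rewrite qg_one_norm.
have := pi0hat_classM h; rewrite qg_mul1x qg_one_norm => e.
by apply: (mulgI (pi0hat_class (qg_one G q))); rewrite mulg1 -e.
Qed.

End ComponentClass.

(** * The constant module attached to a pi0hat(G)-module *)

Section ConstantModule.
Variables (R : realType) (Q : topologicalType).
Variables (hQ : hausdorff_space Q) (lQ : locally_path_connected R Q).
Variable G : qgroup R Q.

Section Object.
Variable M : group_module (pi0hat G).
Local Notation MQ := (const_qgroup hQ lQ (Algebra.to_multiplicative M)).

Definition const_act (z : fib_prod G MQ) : MQ :=
  (grm_act (pi0hat_class (val z).1) ((val z).2.1 : M), (val z).2.2).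

Lemma const_act_continuous : continuous const_act.
Proof.
apply: (@pair_continuous _ (discrete_topology M) Q); last first.
  by move=> z; apply: cvg_comp (@val_snd_continuous _ _ G MQ z) _; exact: cvg_snd.
apply: (@discrete_op2_continuous _ (pi0hat G) M M (@grm_act _ M)
  (fun z : fib_prod G MQ => pi0hat_class (val z).1)
  (fun z : fib_prod G MQ => (val z).2.1)).
- apply: (@comp_continuous _ _ (discrete_topology (pi0hat G))
    (fun z : fib_prod G MQ => (val z).1)); last exact: pi0hat_class_continuous.
  exact: val_fst_continuous.
- apply: (@comp_continuous _ _ (discrete_topology M)
    (fun z : fib_prod G MQ => (val z).2)); last by move=> x; exact: cvg_fst.
  exact: val_snd_continuous.
Qed.

Definition const_gmodule : gmodule G.
Proof.
refine (@GModule R Q G MQ _ const_act const_act_continuous _ _ _ _).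
- move=> [m p] [n q] h h'; congr (_, _); last exact: h.
  exact: (@addrC M).
- by [].
- by move=> [m q] h; rewrite /const_act /= pi0hat_class1 grm_act1.
- move=> a b [m q] hab hbn hl hr.
  by rewrite /const_act /= pi0hat_classM grm_actM.
- move=> a [m p] [n q] *; rewrite /const_act /=; congr (_, _).
  exact: grm_actD.
Defined.

Lemma const_gmodule_discrete : is_discrete_gmodule hQ lQ const_gmodule.
Proof.
exists M, id, id; split=> //; split; try by split=> // x; exact: cvg_id.
all: by move=> x y h h'; rewrite (Prop_irrelevance h h').
Qed.

End Object.

Section Morphism.
Variables M N : group_module (pi0hat G).

Definition const_map (f : M -> N) (x : const_gmodule M) : const_gmodule N :=
  (f x.1, x.2).

Lemma const_map_hom (f : M -> N) :
  is_group_module_hom f -> is_gmodule_hom (const_map f).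
Proof.
move=> [fD fa]; split; last first.
  by move=> a [m q] h h'; congr (_, _); exact: fa.
split; last by move=> [m p] [n q] h h'; congr (_, _); exact: fD.
split=> //.
apply: (@pair_continuous _ (discrete_topology N) Q) => x; last exact: cvg_snd.
apply: (@discrete_op2_continuous _ M M N (fun m _ => f m) fst fst) => y;
  exact: cvg_fst.
Qed.

(** Connectedness of [Q] makes the first coordinate of [g (m, q)] independent of
    [q]; a base point [q0] then serves to define [f]. *)
Lemma const_map_full (g : const_gmodule M -> const_gmodule N) :
  [set: Q] !=set0 -> connected [set: Q] -> is_gmodule_hom g ->
  exists2 f : M -> N, is_group_module_hom f & const_map f = g.
Proof.
move=> [q0 _] cQ [[[cg ng] gM] ga].
pose f m : N := (g (m, q0)).1.
have gE m q : g (m, q) = (f m, q).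
  rewrite [LHS]surjective_pairing; congr (_, _); last exact: (ng (m, q)).
  apply: (@locally_constant_on_connected Q N (fun q => (g (m, q)).1) setT) => //.
  move=> p; apply: (@cvg_comp _ _ _ (fun q => (m, q)) (fun x => (g x).1)).
    apply: (@pair_continuous _ (discrete_topology M) Q) => r; first exact: cvg_cst.
    exact: cvg_id.
  by apply: (@cvg_comp _ _ _ g fst); [exact: (cg (m, p)) | exact: cvg_fst].
exists f; last by apply/funext => -[m q]; rewrite gE.
split=> [m n|].
  have := gM (m, q0) (n, q0) erefl; rewrite !gE => /(_ erefl).
  by move=> /(congr1 fst).
(* A generator is the class of any point [a] of the component [c], and [g]
   commutes with [a]. *)
apply: equivariant_on_generators => c m.
have [a <-] := pi0P c.
have := ga a (m, qnorm a) erefl; rewrite gE => /(_ erefl).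
by rewrite [X in g X](_ : _ = (grm_act (pi0hat_class a) m, qnorm a)) // gE => -[].
Qed.

End Morphism.

Definition const_functor :
  functor (group_module_category (pi0hat G)) (discrete_gmodule_category G hQ lQ).
Proof.
refine (@Functor (group_module_category (pi0hat G))
  (discrete_gmodule_category G hQ lQ)
  (fun M => exist _ (const_gmodule M) (const_gmodule_discrete M))
  (fun M N f => exist _ _ (const_map_hom (svalP f))) _ _).
- by move=> M; apply: eq_exist; apply/funext => -[].
- by move=> M1 M2 M3 f g; exact: eq_exist.
Defined.

End ConstantModule.

(** * From actions constant on components to pi0hat(G)-modules *)

Section ComponentAction.
Variables (R : realType) (Q : topologicalType) (G : qgroup R Q) (M : zmodType).
Variable rho : G -> M -> M.
Hypotheses
  (rho_cont : forall m, continuous (fun a => rho a m : discrete_topology M))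
  (rho1 : forall q m, rho (qg_one G q) m = m)
  (rhoM : forall (a b : G) (h : qnorm a = qnorm b) m,
     rho (qg_mul (fpair h)) m = rho a (rho b m))
  (rhoD : forall a, {morph rho a : m n / (m + n)%R}).

(** As [a] runs over a component, [rho a m] does not change: it is a continuous
    function of [a] with values in a discrete space. *)
Lemma rho_same_component a b m :
  component_of a = component_of b -> rho a m = rho b m.
Proof. exact: discrete_map_same_component (@rho_cont m). Qed.

Lemma rhoK a : cancel (rho a) (rho (qg_inv a)).
Proof. by move=> m; rewrite -(rhoM (qg_inv_norm a)) qg_mulVx rho1. Qed.

Lemma rhoVK a : cancel (rho (qg_inv a)) (rho a).
Proof. by move=> m; rewrite -(rhoM (esym (qg_inv_norm a))) qg_mulxV rho1. Qed.

(** A point chosen in each component; by [rho_same_component] the choice does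
    not affect how the component acts. *)
Definition pi0_point (c : pi0 G) : G := sval (cid (pi0P c)).

Lemma pi0_pointK c : component_of (pi0_point c) = c.
Proof. exact: svalP (cid (pi0P c)). Qed.

Definition letter_act (c : pi0 G) : M -> M := rho (pi0_point c).
Definition letter_actV (c : pi0 G) : M -> M := rho (qg_inv (pi0_point c)).

Lemma letter_act_component a m : letter_act (component_of a) m = rho a m.
Proof. by apply: rho_same_component; rewrite pi0_pointK. Qed.

(** If the product [x] of a point [a] of [c1] and a point [b] of [c2] lies in
    [c3], then [rho x] is the composite of [rho a] and [rho b], so [c1 c2] acts
    as [c3]. *)
Lemma pi0hat_relators_act w : pi0hat_relators w ->
  forall m, word_act letter_act letter_actV w m = m.
Proof.
move=> [c1 [c2 [c3 [[x [[[[a b] z_in] /= [ca cb] xE] cx] ->]]]]] m /=.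
have ab : qnorm a = qnorm b by exact: (set_mem z_in).
have {xE} xE : qg_mul (fpair ab) = x by rewrite -xE; congr qg_mul; exact: val_inj.
have comp_of (c : pi0 G) y : val c y -> component_of y = c.
  case: (pi0P c) => z <- /= zy; apply/val_inj.
  exact/esym/same_connected_component.
rewrite -(comp_of _ _ ca) -(comp_of _ _ cb) !letter_act_component.
have -> : rho a (rho b (letter_actV c3 m)) = letter_act c3 (letter_actV c3 m).
  by rewrite -(comp_of _ _ cx) letter_act_component -xE rhoM.
exact: rhoVK.
Qed.

Local Notation act := (@pres_act _ (pi0hat_relators (G := G)) M letter_act letter_actV).

Lemma pi0hat_actD x : {morph act x : m n / (m + n)%R}.
Proof.
rewrite /pres_act; elim: (repr x)%qT => //= -[c b] w IHw m n /=.
by case: b; rewrite /= IHw; exact: rhoD.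
Qed.

Let letterK c : cancel (letter_act c) (letter_actV c). Proof. exact: rhoK. Qed.
Let letterVK c : cancel (letter_actV c) (letter_act c). Proof. exact: rhoVK. Qed.

Definition component_module : group_module (pi0hat G) :=
  @GroupModule (pi0hat G) M act
    (pres_act1 letterK letterVK pi0hat_relators_act)
    (pres_actM letterK letterVK pi0hat_relators_act)
    pi0hat_actD.

Lemma component_module_class a m :
  @grm_act _ component_module (pi0hat_class a) m = rho a m.
Proof.
by rewrite -letter_act_component
  -(pres_act_gen letterK letterVK pi0hat_relators_act).
Qed.

End ComponentAction.

(** * Trivialized modules are constant *)

Section Trivialized.
Variables (R : realType) (Q : topologicalType).
Variables (hQ : hausdorff_space Q) (lQ : locally_path_connected R Q).
Variables (G : qgroup R Q) (N : gmodule G) (M : zmodType).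
Local Notation MQ := (const_qgroup hQ lQ (Algebra.to_multiplicative M)).
Variables (f : N -> MQ) (g : MQ -> N).
Hypotheses (hf : is_qgroup_hom f) (hg : is_qgroup_hom g)
  (fK : cancel f g) (gK : cancel g f).

Lemma trivialization_over (a : G) (m : M) : qnorm a = qnorm (g (m, qnorm a)).
Proof. by rewrite hg.1.2. Qed.

(** The action of [a] on the fibre over its own image in [Q], read in the
    trivialization. *)
Definition fibre_act (a : G) (m : M) : M :=
  (f (gm_act (fpair (trivialization_over a m)))).1.

(** Every point of [N] over the image of [a] is of the form [g (m, qnorm a)], so
    [fibre_act] determines the whole action. *)
Lemma fibre_actE (a : G) (n : N) (h : qnorm a = qnorm n) :
  f (gm_act (fpair h)) = (fibre_act a (f n).1, qnorm a).
Proof.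
rewrite [LHS]surjective_pairing; congr (_, _); last first.
  by apply: etrans (hf.1.2 _) _; rewrite gm_act_norm.
rewrite /fibre_act; congr (f (gm_act _)).1; apply: fpair_eq => //.
by rewrite h -hf.1.2 -surjective_pairing fK.
Qed.

Lemma fibre_act_continuous m :
  continuous (fun a => fibre_act a m : discrete_topology M).
Proof.
have cpair : continuous (fun a => fpair (trivialization_over a m)).
  apply: (@continuous_comp_initial _ _ _ (val : fib_prod G N -> _)).
  apply: (@pair_continuous _ G N id (fun a => g (m, qnorm a))) => a.
    exact: cvg_id.
  apply: (@comp_continuous _ MQ N (fun a => (m, qnorm a))); last exact: hg.1.1.
  apply: (@pair_continuous _ (discrete_topology M) Q); first by move=> ?; exact: cvg_cst.
  exact: qnorm_continuous.
apply: (@comp_continuous _ MQ (discrete_topology M)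
  (fun a => f (gm_act (fpair (trivialization_over a m)))) fst).
  apply: (@comp_continuous _ N MQ _ f); last exact: hf.1.1.
  by apply: (@comp_continuous _ _ N _ gm_act) => //; exact: gm_act_continuous.
by move=> x; exact: cvg_fst.
Qed.

Lemma fibre_act1 q m : fibre_act (qg_one G q) m = m.
Proof.
pose n := g (m, q).
have nq : qnorm n = q by rewrite hg.1.2.
have h : qnorm (qg_one G (qnorm n)) = qnorm n by rewrite qg_one_norm.
by have := fibre_actE h; rewrite gm_act1 gK nq => /(congr1 fst) /= <-.
Qed.

Lemma fibre_actM (a b : G) (h : qnorm a = qnorm b) m :
  fibre_act (qg_mul (fpair h)) m = fibre_act a (fibre_act b m).
Proof.
pose n := g (m, qnorm b).
have hbn : qnorm b = qnorm n by rewrite hg.1.2.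
have hl : qnorm (qg_mul (fpair h)) = qnorm n by rewrite qg_mul_norm /= h.
have hr : qnorm a = qnorm (gm_act (fpair hbn)) by rewrite gm_act_norm /= h.
have := congr1 f (gm_actM hl hr); rewrite !fibre_actE gK => /(congr1 fst).
by [].
Qed.

Lemma fibre_actD a : {morph fibre_act a : m n / (m + n)%R}.
Proof.
move=> m n; set x := g (m, qnorm a); set y := g (n, qnorm a).
have hxy : qnorm x = qnorm y by rewrite !hg.1.2.
have hx : qnorm a = qnorm x by rewrite hg.1.2.
have hy : qnorm a = qnorm y by rewrite hg.1.2.
have hl : qnorm a = qnorm (qg_mul (fpair hxy)) by rewrite qg_mul_norm.
have hr : qnorm (gm_act (fpair hx)) = qnorm (gm_act (fpair hy)).
  by rewrite !gm_act_norm.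
have := congr1 f (gm_actD hl hr).
have hfxy : qnorm (f x) = qnorm (f y) by rewrite !hf.1.2.
rewrite fibre_actE (hf.2 _ _ hxy hfxy).
have hfr : qnorm (f (gm_act (fpair hx))) = qnorm (f (gm_act (fpair hy))).
  by rewrite !hf.1.2.
rewrite (hf.2 _ _ hr hfr) => /(congr1 fst) /=.
by rewrite /const_mul /= !fibre_actE !gK.
Qed.

Definition fibre_module : group_module (pi0hat G) :=
  component_module fibre_act_continuous fibre_act1 fibre_actM fibre_actD.

(** In the constant module [a] acts through its class, which by construction of
    [fibre_module] acts as [fibre_act a]. *)
Lemma trivialization_equivariant (a : G) (n : N) (h : qnorm a = qnorm n)
    (h' : qnorm a = qnorm (f n : const_gmodule hQ lQ fibre_module)) :
  f (gm_act (fpair h)) =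
  gm_act (fpair h' : fib_prod G (const_gmodule hQ lQ fibre_module)).
Proof.
rewrite fibre_actE; congr (_, _); last exact: h'.
by rewrite -[RHS]/(grm_act _ _) component_module_class.
Qed.

Lemma trivialization_hom :
  is_gmodule_hom (N' := const_gmodule hQ lQ fibre_module) f.
Proof. by split=> // a n h h'; exact: trivialization_equivariant. Qed.

Lemma trivialization_inv_hom :
  is_gmodule_hom (N := const_gmodule hQ lQ fibre_module) g.
Proof.
split=> // a x h h'; apply: (can_inj fK); rewrite gK.
have hx : qnorm a = qnorm (f (g x) : const_gmodule hQ lQ fibre_module).
  by rewrite gK.
rewrite (trivialization_equivariant h' hx).
exact: (congr1 gm_act (fpair_eq h hx erefl (esym (gK x)))).
Qed.

End Trivialized.

(** * The equivalence of categories *)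

Theorem proposition1p24 (R : realType) (Q : topologicalType)
    (hQ : hausdorff_space Q)
    (neQ : [set: Q] !=set0) (cQ : connected [set: Q])
    (lQ : locally_path_connected R Q)
    (G : qgroup R Q) :
  equivalent_categories
    (discrete_gmodule_category G hQ lQ)
    (group_module_category (pi0hat G)).
Proof.
apply: (@equivalence_of_fully_faithful _ _ (const_functor hQ lQ G)).
- move=> M N [g hg]; have [f hf fg] := const_map_full neQ cQ hg.
  by exists (exist _ f hf); exact: eq_exist.
- move=> M N [f hf] [g hg] /(congr1 sval) /= fg; apply: eq_exist.
  have [q _] := neQ; apply/funext => m.
  by have /(congr1 fst) := congr1 (fun u => u (m, q)) fg.
- move=> [N /[dup] dN [M [f [g [hf hg fK gK]]]]].
  exists (fibre_module hf hg fK gK), (exist _ g (trivialization_inv_hom hf hg fK gK)).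
  exists (exist _ f (trivialization_hom hf hg fK gK)).
  by split; apply: eq_exist; apply/funext.
Qed.
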